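(* Let $0<b<a$ be real numbers with $a/b\in\mathbb{Q}$, and let $(U_l)_{l\ge0}$ be an averaging sequence of finite approximants of $\Lambda_{a,b}$. Let $h,g:\mathbb{Z}\to\mathbb{C}$ be weight functions with $\|h\|<+\infty$ and $\|g\|<+\infty$. Then, for every $q\in\mathbb{R}$, $$I_h(q)\le\|h\|^2,$$ and $$\|h-g\|=0\ \Longrightarrow\ I_h(q)=I_g(q).$$
   Context: $\eta_n=(-1)^{s(n)}$ for $n\ge0$, where $s(n)$ is the sum of the binary digits of $n$. Put $f(0)=0$, $f(n)=\sum_{0\le m\le n-1}\bigl(\tfrac12(a+b)+\tfrac12(a-b)\eta_m\bigr)$ for $n\ge1$, $f(n)=-f(-n)$ for $n<0$; the Thue-Morse quasicrystal is $\Lambda_{a,b}=\{f(n):n\in\mathbb{Z}\}$. Functions on $\Lambda_{a,b}$ are identified with functions on $\mathbb{Z}$ via $n\mapsto f(n)$. An averaging sequence of finite approximants of $\Lambda_{a,b}$ is a sequence $U_l=\rho_lJ\cap\Lambda_{a,b}$, $l\ge0$, where $J$ is a closed (bounded) interval whose interior contains $0$ and $(\rho_l)_{l\ge0}$ is a strictly increasing sequence of positive numbers. For $w:\mathbb{Z}\to\mathbb{C}$, the Marcinkiewicz pseudo-norm is $$\|w\|=\limsup_{l\to+\infty}\frac1{\mathrm{card}(U_l)}\sum_{n\in\mathbb{Z},\,f(n)\in U_l}|w(n)|,$$ and the intensity per diffracting site at $q$ is $$I_w(q)=\limsup_{l\to+\infty}\Bigl|\frac1{\mathrm{card}(U_l)}\sum_{f(n)\in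 U_l}w(n)e^{-iqf(n)}\Bigr|^2.$$ The relation $\|h-g\|=0$ is the Marcinkiewicz equivalence relation. The same averaging sequence is used for all these quantities. *)

(* Defs.v *)
From mathcomp Require Import all_boot all_order all_algebra.
From mathcomp Require Import all_classical all_reals all_analysis.
From mathcomp Require Import finmap complex.
Import Order.TTheory GRing.Theory Num.Theory.
Import numFieldNormedType.Exports.

Set Implicit Arguments.
Unset Strict Implicit.
Unset Printing Implicit Defensive.

Local Open Scope classical_set_scope.
Local Open Scope ring_scope.

(* Since n < 2 ^ n, the binary digits of n of index i >= n all vanish. *)
Definition binary_digit_sum (n : nat) : nat :=
  (\sum_(i < n) (n %/ 2 ^ i) %% 2)%N.

Definition thue_morse (R : realType) (n : nat) : R :=
  (-1) ^+ binary_digit_sum n.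

Definition tm_pos_nat (R : realType) (a b : R) (n : nat) : R :=
  \sum_(0 <= m < n) (2^-1 * (a + b) + 2^-1 * (a - b) * thue_morse R m).

(* Negz n is the integer - n.+1. *)
Definition tm_pos (R : realType) (a b : R) (n : int) : R :=
  match n with
  | Posz m => tm_pos_nat a b m
  | Negz m => - tm_pos_nat a b m.+1
  end.

Definition tm_quasicrystal (R : realType) (a b : R) : set R :=
  range (tm_pos a b).

(* Only positivity and strict monotonicity of rho are required, not rho --> +oo. *)
Definition averaging_sequence (R : realType) (a b : R) (U : nat -> set R) :
    Prop :=
  exists (c d : R) (rho : nat -> R),
    let J := `[c, d]%classic : set R in
    [/\ interior J 0,
        forall l, 0 < rho l,
        {homo rho : l m / (l < m)%N >-> l < m} &
        forall l, U l = [set rho l * x | x in J] `&` tm_quasicrystal a b].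

Definition cardU (R : realType) (A : set R) : nat := #|` fset_set A |.

Definition site_indices (R : realType) (a b : R) (A : set R) : set int :=
  [set n | A (tm_pos a b n)].

Definition marcinkiewicz_norm (R : realType) (a b : R) (U : nat -> set R)
    (w : int -> R[i]) : \bar R :=
  limn_esup (fun l =>
    ((cardU (U l))%:R^-1 *
      \sum_(n \in site_indices a b (U l)) Normc.normc (w n))%:E).

Definition expi (R : realType) (t : R) : R[i] := Complex (cos t) (sin t).

Definition intensity (R : realType) (a b : R) (U : nat -> set R)
    (w : int -> R[i]) (q : R) : \bar R :=
  limn_esup (fun l =>
    (Normc.normc
      ((cardU (U l))%:R^-1 *
        \sum_(n \in site_indices a b (U l))
          w n * expi (- (q * tm_pos a b n))) ^+ 2)%:E).

(* Main.v *)
Require Import Defs.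
From mathcomp Require Import all_boot all_order all_algebra.
From mathcomp Require Import all_classical all_reals all_analysis.
From mathcomp Require Import complex.
From mathcomp Require Import lra.
Import Order.TTheory GRing.Theory Num.Theory.
Import numFieldNormedType.Exports.

Set Implicit Arguments.
Unset Strict Implicit.
Unset Printing Implicit Defensive.

Local Open Scope classical_set_scope.
Local Open Scope ring_scope.

(** Since [expi] has modulus 1, the triangle inequality bounds the modulus of each phased mean of
    [w] by the mean of [|w|] ([normc_mean_le]). Squaring and passing to the limsup gives the first
    claim ([limn_esup_sqr_le]). For the second, the moduli of the phased means of [h] and [g] differ
    by at most the mean of [|h - g|] ([normc_mean_perturb]), whose limsup is 0. Both moduli are
    eventually bounded because the norms are finite, so their squares have the same limsup
    ([limn_esup_sqr_le_perturb], used in both directions). The geometry enters through finiteness: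
    gaps of length at least [b > 0] leave finitely many sites in each [U l], so the sums over site
    indices are genuine finite sums and the triangle inequality applies. *)

Section LimnEsup.
Context {R : realType}.
Implicit Types (u : nat -> \bar R) (x y d : nat -> R) (t : \bar R).

Lemma limn_esup_lt_near u t :
  (limn_esup u < t)%E -> \forall n \near \oo, (u n <= t)%E.
Proof.
move=> /ereal_inf_lt[_ [V Voo <-] Vt].
apply: filterS Voo => n Vn; apply: le_trans (ltW Vt).
by apply: ereal_sup_ubound; exists n.
Qed.

Lemma limn_esup_le_near u t :
  (\forall n \near \oo, (u n <= t)%E) -> (limn_esup u <= t)%E.
Proof.
move=> ut; apply: (@le_trans _ _ (ereal_sup (u @` [set n | (u n <= t)%E]))).
  by apply: ereal_inf_lbound; exists [set n | (u n <= t)%E].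
by apply: ge_ereal_sup => _ [n /= unt <-].
Qed.

Lemma limn_esup_ge0 u : (forall n, 0 <= u n)%E -> (0 <= limn_esup u)%E.
Proof. by apply: limf_esup_ge0; exact: filter_not_empty. Qed.

Lemma limn_esup_fin_num x :
  (forall n, 0 <= x n) -> (limn_esup (fun n => (x n)%:E) < +oo)%E ->
  limn_esup (fun n => (x n)%:E) \is a fin_num.
Proof. by move=> x0 xoo; rewrite ge0_fin_numE// limn_esup_ge0. Qed.

Lemma limn_esup_sqr_le x y :
  (forall n, 0 <= x n <= y n) -> (limn_esup (fun n => (y n)%:E) < +oo)%E ->
  (limn_esup (fun n => (x n ^+ 2)%:E) <=
   limn_esup (fun n => (y n)%:E) ^+ 2)%E.
Proof.
move=> xy yoo.
have y0 n : 0 <= y n by have /andP[/le_trans] := xy n; apply.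
have Lfin := limn_esup_fin_num y0 yoo.
set L := limn_esup (fun n => (y n)%:E) in yoo Lfin *.
have L0 : (0 <= L)%E by apply: limn_esup_ge0 => n; rewrite lee_fin.
have LE : L = (fine L)%:E by rewrite fineK.
move: L0; rewrite LE lee_fin; set r := fine L => r0.
rewrite -EFin_expe; apply/lee_addgt0Pr => e e0.
(* For [d <= 1], [(r + d)^2 = r^2 + d (2 r + d) <= r^2 + d s], so [d <= e / s] keeps the excess
   below [e]. *)
pose s := 2 * r + 1.
have s0 : 0 < s by rewrite /s; lra.
pose d := Num.min 1 (e / s).
have d0 : 0 < d by rewrite lt_min ltr01 divr_gt0.
have d1 : d <= 1 by rewrite ge_min lexx.
have ds : d * s <= e by rewrite -ler_pdivlMr// ge_min lexx orbT.
have : (L < (r + d)%:E)%E by rewrite LE lte_fin ltrDl.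
move=> /limn_esup_lt_near near_y.
apply: limn_esup_le_near; apply: filterS near_y => n.
rewrite -EFinD !lee_fin => yn.
have /andP[x0 xyn] := xy n.
apply: (@le_trans _ _ ((r + d) ^+ 2)).
  by rewrite lerXn2r ?nnegrE// ?(le_trans xyn)//; lra.
by rewrite /s in ds; nra.
Qed.

(* [x^2 - x'^2 = (x - x') (x + x')], where the first factor is at most [d],
   which tends to [0], and the second is eventually bounded. *)
Lemma limn_esup_sqr_le_perturb x x' y y' d :
  (forall n, 0 <= x n <= y n) -> (forall n, 0 <= x' n <= y' n) ->
  (forall n, 0 <= d n) -> (forall n, x n <= x' n + d n) ->
  (limn_esup (fun n => (y n)%:E) < +oo)%E ->
  (limn_esup (fun n => (y' n)%:E) < +oo)%E ->
  limn_esup (fun n => (d n)%:E) = 0%E ->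
  (limn_esup (fun n => (x n ^+ 2)%:E) <= limn_esup (fun n => (x' n ^+ 2)%:E))%E.
Proof.
move=> xy xy' d0 xd yoo yoo' dlim.
have bounded z : (forall n, 0 <= z n) ->
    (limn_esup (fun n => (z n)%:E) < +oo)%E ->
    exists2 M : R, 0 < M & \forall n \near \oo, z n <= M.
  move=> z0 zoo; have zfin := limn_esup_fin_num z0 zoo.
  exists (fine (limn_esup (fun n => (z n)%:E)) + 1).
    by rewrite ltr_wpDl// fine_ge0// limn_esup_ge0.
  have : (limn_esup (fun n => (z n)%:E) <
      (fine (limn_esup (fun n => (z n)%:E)) + 1)%:E)%E.
    by rewrite -[ltLHS]fineK// lte_fin ltrDl.
  by move=> /limn_esup_lt_near; apply: filterS => n; rewrite lee_fin.
have y0 n : 0 <= y n by have /andP[/le_trans] := xy n; apply.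
have y'0 n : 0 <= y' n by have /andP[/le_trans] := xy' n; apply.
have [M M0 yM] := bounded y y0 yoo.
have [M' M'0 yM'] := bounded y' y'0 yoo'.
(* The right-hand limsup is at most the square of a finite one, so the rest is an epsilon argument
   over the reals. *)
have x'fin : limn_esup (fun n => (x' n ^+ 2)%:E) \is a fin_num.
  apply: limn_esup_fin_num => [n|]; first exact: sqr_ge0.
  apply: le_lt_trans (limn_esup_sqr_le xy' yoo') _.
  by rewrite ltey_eq fin_numX// limn_esup_fin_num.
apply/lee_addgt0Pr => e e0.
set L := limn_esup (fun n => (x' n ^+ 2)%:E) in x'fin *.
rewrite -(fineK x'fin) -EFinD.
have : (L < (fine L + e / 2)%:E)%E.
  by rewrite -[ltLHS]fineK// lte_fin ltrDl divr_gt0.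
move=> /limn_esup_lt_near near_x'.
have MM0 : 0 < M + M' by rewrite addr_gt0.
(* This tolerance makes [d n * (M + M') <= e / 2]; the other half of [e] is spent on [x' n ^+ 2]. *)
have : (limn_esup (fun n => (d n)%:E) < (e / 2 / (M + M'))%:E)%E.
  by rewrite dlim lte_fin !divr_gt0.
move=> /limn_esup_lt_near near_d.
apply: limn_esup_le_near.
apply: filterS2 (filterI near_x' near_d) (filterI yM yM') => n [].
rewrite !lee_fin ler_pdivlMr// => x'n dn [yn y'n].
have /andP[? ?] := xy n; have /andP[? ?] := xy' n.
have := d0 n; have := xd n => xdn dn0.
have : d n * (x n + x' n) <= d n * (M + M') by rewrite ler_wpM2l//; lra.
have : (x n - x' n) * (x n + x' n) <= d n * (x n + x' n).
  by rewrite ler_wpM2r//; lra.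
by rewrite -subr_sqr; lra.
Qed.

End LimnEsup.

Section ThueMorsePositions.
Context {R : realType} {a b : R}.
Hypotheses (b_gt0 : 0 < b) (b_lt_a : b < a).

(** The expression is increasing in [t], with slope [(a - b) / 2], and equals [b] at [t = -1]. *)
Lemma tm_gap_ge (t : R) :
  -1 <= t -> b <= 2^-1 * (a + b) + 2^-1 * (a - b) * t.
Proof. by move: b_lt_a; nra. Qed.

Lemma tm_pos_nat_ge (n : nat) : b * n%:R <= tm_pos_nat a b n.
Proof.
rewrite mulr_natr -[leLHS]/(b *+ n) -[n in b *+ n]subn0 -sumr_const_nat.
apply: ler_sum => m _; apply: tm_gap_ge.
have : `|thue_morse R m| <= 1 by rewrite normrX normrN1 expr1n.
by rewrite ler_norml => /andP[].
Qed.

Lemma norm_tm_pos_ge (n : int) : b * `|n|%N%:R <= `|tm_pos a b n|.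
Proof.
by case: n => n /=; rewrite ?normrN (le_trans (tm_pos_nat_ge _))// ler_norm.
Qed.

(** Positions grow at least linearly, so [|tm_pos a b n| <= K] forces [|n| <= K / b]. *)
Lemma finite_site_indices (A : set R) (K : R) :
  (forall x, A x -> `|x| <= K) -> finite_set (site_indices a b A).
Proof.
move=> AK; have [N KN] : exists N : nat, K / b < N%:R.
  by exists (Num.truncn (K / b)).+1; exact: truncnS_gt.
apply: (@sub_finite_set _ _ (Posz @` `I_N `|` Negz @` `I_N)); last first.
  by rewrite finite_setU; split; apply: finite_image; exact: finite_II.
move=> n /AK nK; have : (`|n| < N)%N.
  rewrite -(ltr_nat R); apply: le_lt_trans KN.
  by rewrite ler_pdivlMr// mulrC (le_trans (norm_tm_pos_ge n)).
(* [Negz n] has absolute value [n.+1], whence the weakening by one. *)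
by case: n {nK} => n /= nN; [left|right]; exists n => //=; exact: ltnW.
Qed.

Lemma finite_site_indices_averaging (U : nat -> set R) (l : nat) :
  averaging_sequence a b U -> finite_set (site_indices a b (U l)).
Proof.
move=> [c [d [rho [_ rho0 _ UE]]]].
apply: (@finite_site_indices _ (rho l * (`|c| + `|d|))) => y.
rewrite UE => -[[x /= xcd <-] _].
rewrite normrM gtr0_norm// ler_pM2l//.
move: xcd; rewrite in_itv /= => /andP[cx xd].
have := ler_norm d; have := ler_norm (- c); rewrite normrN.
by have := normr_ge0 c; have := normr_ge0 d; rewrite ler_norml; lra.
Qed.

End ThueMorsePositions.

Section ComplexMeans.
Context {R : realType} {T : choiceType}.
Local Notation normc := (@Normc.normc R).

Lemma normc_ge0 (z : R[i]) : 0 <= normc z.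
Proof. by case: z => u v; exact: sqrtr_ge0. Qed.

Lemma normc_nat (k : nat) : normc k%:R = k%:R.
Proof. by rewrite normcMn Normc.normc1. Qed.

Lemma normc_expi (t : R) : normc (expi t) = 1.
Proof. by rewrite /expi /= cos2Dsin2 sqrtr1. Qed.

Lemma normc_fsum_le (A : set T) (f : T -> R[i]) : finite_set A ->
  normc (\sum_(n \in A) f n) <= \sum_(n \in A) normc (f n).
Proof.
move=> Afin; rewrite !fsbig_finite//=.
elim/big_ind2 : _ => [|u x v y ux vy|//]; first by rewrite Normc.normc0.
exact: le_trans (le_normcD _ _) (lerD ux vy).
Qed.

Lemma normc_mean_le (A : set T) (k : nat) (w e : T -> R[i]) :
  finite_set A -> (forall n, normc (e n) = 1) ->
  normc (k%:R^-1 * \sum_(n \in A) w n * e n) <=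
  k%:R^-1 * \sum_(n \in A) normc (w n).
Proof.
move=> Afin e1; rewrite Normc.normcM Normc.normcV normc_nat.
rewrite ler_wpM2l ?invr_ge0//.
apply: le_trans (normc_fsum_le _ Afin) _.
by under eq_fsbigr do rewrite Normc.normcM e1 mulr1.
Qed.

(** Split [v = w + (v - w)] and apply [normc_mean_le] to the difference. *)
Lemma normc_mean_perturb (A : set T) (k : nat) (v w e : T -> R[i]) :
  finite_set A -> (forall n, normc (e n) = 1) ->
  normc (k%:R^-1 * \sum_(n \in A) v n * e n) <=
  normc (k%:R^-1 * \sum_(n \in A) w n * e n) +
  k%:R^-1 * \sum_(n \in A) normc (v n - w n).
Proof.
move=> Afin e1.
have -> : \sum_(n \in A) v n * e n =
    \sum_(n \in A) w n * e n + \sum_(n \in A) (v n - w n) * e n.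
  rewrite -fsbig_split//=; apply: eq_fsbigr => n _.
  by rewrite -mulrDl addrC subrK.
rewrite mulrDr; apply: le_trans (le_normcD _ _) _.
by rewrite lerD2l; exact: normc_mean_le.
Qed.

End ComplexMeans.

Theorem proposition6p1 (R : realType) (a b : R) (U : nat -> set R)
    (h g : int -> R[i])
    (b_gt0 : 0 < b) (b_lt_a : b < a)
    (ab_rat : exists r : rat, a / b = ratr r)
    (U_avg : averaging_sequence a b U)
    (h_fin : (marcinkiewicz_norm a b U h < +oo)%E)
    (g_fin : (marcinkiewicz_norm a b U g < +oo)%E)
    (q : R) :
  (intensity a b U h q <= marcinkiewicz_norm a b U h ^+ 2)%E /\
  (marcinkiewicz_norm a b U (fun n => h n - g n) = 0%E ->
   intensity a b U h q = intensity a b U g q).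
Proof.
have Ufin l := finite_site_indices_averaging b_gt0 b_lt_a l U_avg.
have mean_le w l : 0 <= Normc.normc ((cardU (U l))%:R^-1 *
      \sum_(n \in site_indices a b (U l))
        w n * expi (- (q * tm_pos a b n))) <=
    (cardU (U l))%:R^-1 *
      \sum_(n \in site_indices a b (U l)) Normc.normc (w n).
  rewrite normc_ge0 /=; apply: normc_mean_le => // n; exact: normc_expi.
split; first exact: limn_esup_sqr_le (mean_le h) h_fin.
(* A one-sided bound for arbitrary weights, to be applied to [(h, g)] and to [(g, h)]. *)
have intensity_le v w :
    (marcinkiewicz_norm a b U v < +oo)%E ->
    (marcinkiewicz_norm a b U w < +oo)%E ->
    marcinkiewicz_norm a b U (fun n => v n - w n) = 0%E ->
    (intensity a b U v q <= intensity a b U w q)%E.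
  move=> v_fin w_fin vw0.
  apply: limn_esup_sqr_le_perturb (mean_le v) (mean_le w) _ _ v_fin w_fin vw0.
    (* The mean of [|v - w|] is nonnegative because it dominates a modulus. *)
    move=> l; have /andP[] := mean_le (fun n => v n - w n) l.
    exact: le_trans.
  by move=> l; apply: normc_mean_perturb => // n; exact: normc_expi.
move=> hg0; apply/eqP; rewrite eq_le !intensity_le//.
(* The swapped application needs the pseudo-norm of [g - h] to vanish, which follows from
   [|g n - h n| = |h n - g n|]. *)
rewrite -hg0 /marcinkiewicz_norm; congr limn_esup; apply/funext => l.
by under eq_fsbigr do rewrite -normcN opprB.
Qed.
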